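(* Let $(X,T)$ be a Polish dynamical system and assume $X$ is compact. If $V\subseteq\mathcal{M}_T(X)$ is closed, then $G_V=\{x\in X: V(x)\subseteq V\}$ is a $\boldsymbol{\Pi}^0_3$ set. If $U\subseteq\mathcal{M}_T(X)$ is open, then ${}^{U}G=\{x\in X: V(x)\cap U\ne\emptyset\}$ is a $\boldsymbol{\Sigma}^0_3$ set.
   Context: A Polish dynamical system $(X,T)$ is a Polish space $X$ with a continuous map $T\colon X\to X$. $\mathcal{M}(X)$ is the space of Borel probability measures on $X$ with the weak$^*$ topology; $\mathcal{M}_T(X)$ is the subspace of $T$-invariant measures (''open''/''closed'' are relative to $\mathcal{M}_T(X)$). For $x\in X$, $n\ge1$, $\mathcal{E}(x,n)=\frac1n\sum_{j=0}^{n-1}\delta_{T^j(x)}$, and $V(x)$ is the set of limit points (limits of convergent subsequences) in $\mathcal{M}(X)$ of $(\mathcal{E}(x,n))_n$. $\boldsymbol{\Sigma}^0_3$ sets are the countable unions of $G_\delta$ sets; $\boldsymbol{\Pi}^0_3$ sets are the countable intersections of $F_\sigma$ sets. *)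

(* Defs.v *)
From HB Require Import structures.
From mathcomp Require Import all_boot all_order all_algebra.
From mathcomp Require Import all_classical all_reals all_analysis borel_hierarchy.

Set Implicit Arguments.
Unset Strict Implicit.
Unset Printing Implicit Defensive.

Import Order.TTheory GRing.Theory Num.Theory.
Import numFieldNormedType.Exports.

Local Open Scope classical_set_scope.
Local Open Scope ring_scope.

Section Polish.
Context (R : realType) (X : topologicalType).

Definition is_metric (d : X -> X -> R) : Prop :=
  [/\ forall x y, 0 <= d x y,
      forall x y, d x y = 0 <-> x = y,
      forall x y, d x y = d y x &
      forall x y z, d x z <= d x y + d y z].

Definition metric_induces_topology (d : X -> X -> R) : Prop :=
  forall (x : X) (A : set X),
    nbhs x A <-> exists2 e : R, 0 < e & [set y | d x y < e] `<=` A.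

Definition metric_complete (d : X -> X -> R) : Prop :=
  forall u : nat -> X,
    (forall e : R, 0 < e -> exists N : nat, forall m n : nat,
      (N <= m)%N -> (N <= n)%N -> d (u m) (u n) < e) ->
    exists l : X, u @ \oo --> l.

Definition separable : Prop := exists2 D : set X, countable D & dense D.

Definition polish : Prop :=
  separable /\
  exists d : X -> X -> R,
    [/\ is_metric d, metric_induces_topology d & metric_complete d].

End Polish.

Notation borel X := (g_sigma_algebraType (@open X)).

Definition bounded_continuous (R : realType) (X : topologicalType) : Type :=
  {f : X -> R | continuous f /\ bounded_fun f}.

(* A measure is a function on all subsets, whose values on non-Borel sets are
   irrelevant: the topology and the invariance predicate below only depend on
   the values on Borel sets, so two elements agreeing there belong to the same
   open, closed, relatively open and relatively closed sets. *)
Definition borel_prob (R : realType) (X : ptopologicalType) : Type :=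
  probability (borel X) R.

Definition integrals (R : realType) (X : ptopologicalType)
    (mu : probability (borel X) R) : {ptws bounded_continuous R X -> R} :=
  fun f => (\int[mu]_x (sval f x))%R.

(* The weak* topology: the coarsest one making all the maps
   mu |-> \int f dmu continuous, f bounded continuous. *)
HB.instance Definition _ (R : realType) (X : ptopologicalType) :=
  Topological.copy (borel_prob R X) (initial_topology (@integrals R X)).

Definition invariant_measures (R : realType) (X : ptopologicalType)
    (T : X -> X) : set (borel_prob R X) :=
  [set mu : probability (borel X) R |
    forall A : set (borel X), measurable A -> mu (T @^-1` A) = mu A].
Arguments invariant_measures R {X} T.

Section Empirical.
Context (R : realType) (X : ptopologicalType) (T : X -> X) (x : X) (n : nat).

(* The index is shifted: this is E(x, n + 1). *)
Definition empirical : set (borel X) -> \bar R :=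
  mscale (n.+1%:R^-1)%:nng
    (msum (fun j => \d_(iter j T x : borel X)) n.+1).

HB.instance Definition _ := Measure.on empirical.

Let empirical_setT : empirical setT = 1%E.
Proof.
rewrite /empirical /mscale /= /msum.
under eq_bigr do rewrite /= diracT.
rewrite sumEFin sumr_const card_ord -EFinM.
by rewrite mulVf// pnatr_eq0.
Qed.

HB.instance Definition _ :=
  Measure_isProbability.Build _ _ _ empirical empirical_setT.

Definition empirical_prob : borel_prob R X := empirical : probability _ R.

End Empirical.

Definition limit_measures (R : realType) (X : ptopologicalType) (T : X -> X)
    (x : X) : set (borel_prob R X) :=
  [set mu | exists2 k : nat -> nat, increasing_seq k &
    empirical_prob R T x (k n) @[n --> \oo] --> mu].
Arguments limit_measures R {X} T x.

Section Relative.
Context (Y : topologicalType) (A V : set Y).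

Definition open_in : Prop := exists2 O : set Y, open O & V = O `&` A.

Definition closed_in : Prop := exists2 C : set Y, closed C & V = C `&` A.

End Relative.

Section Borel3.
Context (X : topologicalType) (S : set X).

Definition Sigma03 : Prop :=
  exists2 F : (set X)^nat, (forall i, Gdelta (F i)) & S = \bigcup_i F i.

Definition Pi03 : Prop :=
  exists2 F : (set X)^nat, (forall i, Fsigma (F i)) & S = \bigcap_i F i.

End Borel3.

(* Main.v *)
Require Import Defs.
From HB Require Import structures.
From mathcomp Require Import all_boot all_order all_algebra.
From mathcomp Require Import all_classical all_reals all_analysis borel_hierarchy.
From mathcomp Require Import measurable_realfun lra.

Set Implicit Arguments.
Unset Strict Implicit.
Unset Printing Implicit Defensive.

Import Order.TTheory GRing.Theory Num.Theory.
Import numFieldNormedType.Exports.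

Local Open Scope classical_set_scope.
Local Open Scope ring_scope.

(* The limit measures of an orbit meet an open set [O] iff the empirical
   measures visit infinitely often some set of a countable weak* basis whose
   closure lies in [O]; each "infinitely often" is a G_delta condition.  Two
   facts make this work.

   Sequential compactness: an ultrafilter limit of the empirical measures is a
   finitely additive probability [q] on all subsets of [X].  On the space of
   ultrafilters of [X] the sets {G | A \in G} form an algebra on which [q] is
   automatically countably additive, by compactness; its Caratheodory extension
   is pushed forward to a Borel probability on [X] by the map sending an
   ultrafilter to a limit of it.

   The topology: C(X) is separable, so the weak* topology on probabilities is
   governed by the integrals of countably many functions. *)

(** * The space of ultrafilters and its algebra of boxes *)

Definition ultrafilter (X : Type) := {G : set_system X | UltraFilter G}.

Definition principal (X : Type) (x : X) : ultrafilter X :=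
  exist _ (principal_filter x) (principal_filter_ultra x).

HB.instance Definition _ (X : Type) := gen_eqMixin (ultrafilter X).
HB.instance Definition _ (X : Type) := gen_choiceMixin (ultrafilter X).
HB.instance Definition _ (X : pointedType) :=
  isPointed.Build (ultrafilter X) (principal point).

Section UltraBox.
Context {X : pointedType}.
Implicit Types (A B : set X).

Definition ultra_box A : set (ultrafilter X) := [set G | sval G A].

Lemma ultra_box0 : ultra_box set0 = set0.
Proof.
apply/seteqP; split => // -[G GU] /= G0.
exact: filter_not_empty G0.
Qed.

Lemma ultra_boxC A : ultra_box (~` A) = ~` ultra_box A.
Proof.
apply/seteqP; split => -[G GU] /= GA.
  move=> GA'; have : G (~` A `&` A) by exact: filterI.
  rewrite setICl.
  by move=> /filter_not_empty.
by have [] := in_ultra_setVsetC A GU.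
Qed.

Lemma ultra_boxT : ultra_box setT = setT.
Proof. by rewrite -[X in ultra_box X]setC0 ultra_boxC ultra_box0 setC0. Qed.

Lemma ultra_boxI A B : ultra_box (A `&` B) = ultra_box A `&` ultra_box B.
Proof.
apply/seteqP; split => -[G GU] /=; last by case; exact: filterI.
by move=> GAB; split; apply: filterS GAB => x [].
Qed.

Lemma ultra_boxU A B : ultra_box (A `|` B) = ultra_box A `|` ultra_box B.
Proof.
by rewrite -[A `|` B]setCK setCU ultra_boxC ultra_boxI !ultra_boxC setCI !setCK.
Qed.

Lemma preimage_principal A : @principal X @^-1` ultra_box A = A.
Proof. by apply/seteqP; split => x /principal_filterP. Qed.

(** If no finite union of the [A i] covers [B], the differences [C N] are nonempty and form a filter
    base. An ultrafilter refining it contains [B] but none of the [A i], against the assumed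
    inclusion of boxes. *)
Lemma ultra_box_compact (A : (set X)^nat) B :
  ultra_box B `<=` \bigcup_i ultra_box (A i) ->
  exists N, B `<=` \bigcup_(i < N) A i.
Proof.
move=> BA; apply: contrapT => /forallNP nB.
pose C N := B `\` \bigcup_(i < N) A i.
have FC : ProperFilter (filter_from setT C).
  apply: filter_from_proper; last first.
    by move=> N _; have /nonsubset := nB N.
  apply: filter_from_filter; first by exists 0%N.
  move=> i j _ _; exists (maxn i j) => // x [Bx nAx].
  by split; split => //; apply: contra_not nAx => -[k /= kij Akx];
    exists k => //=; rewrite leq_max kij ?orbT.
have [G [GU CG]] := ultraFilterLemma FC.
have GC N : G (C N) by apply: CG; exists N.
have [|i _ /= GAi] := BA (exist _ G GU).
  by apply: filterS (GC 0%N) => x [].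
have : G (A i `&` C i.+1) by exact: filterI.
suff -> : A i `&` C i.+1 = set0 by move=> /filter_not_empty.
by rewrite -subset0 => x [Aix [_]]; apply; exists i => /=.
Qed.

End UltraBox.

Definition ultra_display : measure_display.
Proof. exact: default_measure_display. Qed.

Section UltraAlgebra.
Context (X : pointedType).

Let ultra0 : range (@ultra_box X) set0.
Proof. by exists set0 => //; exact: ultra_box0. Qed.

Let ultraU : setU_closed (range (@ultra_box X)).
Proof.
by move=> _ _ [A _ <-] [B _ <-]; exists (A `|` B); rewrite ?ultra_boxU.
Qed.

Let ultraC : setC_closed (range (@ultra_box X)).
Proof. by move=> _ [A _ <-]; exists (~` A); rewrite ?ultra_boxC. Qed.

HB.instance Definition _ := isAlgebraOfSets.Build ultra_display
  (ultrafilter X) ultra0 ultraU ultraC.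

End UltraAlgebra.

(** * From finitely additive probabilities to measures on ultrafilters *)

Section FinitelyAdditive.
Context {R : realType} {X : pointedType} (q : set X -> R).

Definition finitely_additive_probability : Prop :=
  [/\ forall A, 0 <= q A, q setT = 1 &
      forall A B, A `&` B = set0 -> q (A `|` B) = q A + q B].

Hypothesis qP : finitely_additive_probability.

Lemma fap_set0 : q set0 = 0.
Proof.
case: qP => _ _ /(_ set0 set0); rewrite setI0 setU0 => /(_ erefl) q0.
lra.
Qed.

Lemma fap_bigcup (A : (set X)^nat) n : trivIset setT A ->
  q (\bigcup_(i < n) A i) = \sum_(i < n) q (A i).
Proof.
case: qP => _ _ qU tA; elim: n => [|n IH].
  by rewrite II0 bigcup_set0 big_ord0 fap_set0.
rewrite big_ord_recr /= -IH -qU; last first.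
  rewrite -subset0 => x [[i /= ltin Aix] Anx].
  have iE : i = n by apply: tA => //; exists x.
  by rewrite iE ltnn in ltin.
by rewrite !bigcup_mkord big_ord_recr.
Qed.

(* A set {G | A \in G} is recovered from its trace [A] on the principal
   ultrafilters. *)
Definition ultra_premeasure (Z : set (ultrafilter X)) : \bar R :=
  (q (@principal X @^-1` Z))%:E.

Let ultra_premeasure0 : ultra_premeasure set0 = 0%E.
Proof. by rewrite /ultra_premeasure preimage_set0 fap_set0. Qed.

Let ultra_premeasure_ge0 Z : (0 <= ultra_premeasure Z)%E.
Proof. by rewrite lee_fin; case: qP. Qed.

Let ultra_premeasure_semi_sigma_additive :
  semi_sigma_additive ultra_premeasure.
Proof.
move=> F mF tF [B _ BF].
have /choice[A FA] : forall i, exists A, F i = ultra_box A.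
  by move=> i; have [A _ <-] := mF i; exists A.
have AE i : A i = @principal X @^-1` F i by rewrite FA preimage_principal.
have BE : B = \bigcup_i A i.
  rewrite -[B]preimage_principal BF preimage_bigcup.
  by apply: eq_bigcupr => i _; rewrite AE.
have tA : trivIset setT A.
  apply/trivIsetP => i j _ _ ij; rewrite !AE -preimage_setI.
  by move/trivIsetP : tF => ->.
(* Compactness leaves only finitely many pieces covering [B], so the partial sums equal [q B] from
   [N] on and countable additivity reduces to finite additivity. *)
have [N BN] : exists N, B `<=` \bigcup_(i < N) A i.
  apply: ultra_box_compact; rewrite BF => x [i _].
  by exists i => //; rewrite -FA.
apply: (@cvg_near_cst _ _ _ _ _).
exists N => // n /= Nn.
rewrite -BF /ultra_premeasure preimage_principal.
rewrite (_ : B = \bigcup_(i < n) A i) ?fap_bigcup//.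
  by rewrite -sumEFin big_mkord; apply: eq_bigr => i _; rewrite AE.
apply/seteqP; split; last by rewrite BE => x [i _ ?]; exists i.
by move=> x /BN[i /= iN Aix]; exists i => //=; exact: leq_trans Nn.
Qed.

HB.instance Definition _ := isMeasure.Build ultra_display (ultrafilter X) R
  ultra_premeasure ultra_premeasure0 ultra_premeasure_ge0
  ultra_premeasure_semi_sigma_additive.

Definition ultra_measure :=
  measure_extension (ultra_premeasure : {measure set _ -> \bar R}).

HB.instance Definition _ := Measure.on ultra_measure.

Lemma ultra_measure_box A : ultra_measure (ultra_box A) = (q A)%:E.
Proof.
rewrite /ultra_measure /measure_extension measurable_mu_extE//=; last first.
  by exists A.
by rewrite /ultra_premeasure preimage_principal.
Qed.

Let ultra_measure_setT : ultra_measure setT = 1%E.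
Proof.
by rewrite -ultra_boxT ultra_measure_box; case: qP => _ ->.
Qed.

HB.instance Definition _ :=
  Measure_isProbability.Build _ _ _ ultra_measure ultra_measure_setT.

Definition ultra_probability : probability _ R := ultra_measure.

End FinitelyAdditive.

(** * Bounded continuous functions, orbit averages and empirical integrals *)

Lemma bounded_funP (R : realType) (X : Type) (f : X -> R) :
  bounded_fun f <-> exists M, forall x, `|f x| <= M.
Proof.
split=> [[M [_ fM]]|[M fM]].
  by exists (M + 1) => x; apply: fM => //; rewrite ltrDl.
exists M; split; first exact: num_real.
by move=> x Mx y _; exact: le_trans (fM y) (ltW Mx).
Qed.

Definition BoundedContinuous (R : realType) (X : topologicalType) (f : X -> R)
    (cf : continuous f) (bf : bounded_fun f) : bounded_continuous R X :=
  exist _ f (conj cf bf).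

Section BorelFunctions.
Context {R : realType} {X Y : ptopologicalType}.

Lemma continuous_borel_measurable (f : X -> Y) :
  continuous f -> measurable_fun setT (f : borel X -> borel Y).
Proof.
move=> cf; apply: (measurability (@open Y : set (set (borel Y)))) => //.
move=> _ [U oU <-]; rewrite setTI; apply: sub_sigma_algebra.
by move/continuousP : cf; exact.
Qed.

Lemma continuous_real_measurable (f : X -> R) :
  continuous f -> measurable_fun setT (f : borel X -> R).
Proof.
move=> cf; apply: (measurability _ (RGenOInfty.measurableE R)).
move=> _ [_ [a ->] <-]; rewrite setTI; apply: sub_sigma_algebra.
by move/continuousP : cf; apply; exact: interval_open.
Qed.

Lemma bounded_measurable_integrable d (S : measurableType d)
    (mu : {finite_measure set S -> \bar R}) (f : S -> R) :
  measurable_fun setT f -> bounded_fun f ->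
  mu.-integrable setT (EFin \o f).
Proof.
move=> mf bf; apply: measurable_bounded_integrable => //.
by rewrite -ge0_fin_numE// fin_num_measure.
Qed.

Lemma bounded_continuous_integrable
    (mu : {finite_measure set (borel X) -> \bar R}) (f : X -> R) :
  continuous f -> bounded_fun f ->
  mu.-integrable setT (EFin \o f).
Proof.
move=> cf bf; apply: bounded_measurable_integrable => //.
exact: continuous_real_measurable.
Qed.

End BorelFunctions.

Definition orbit_average (R : realType) (X : Type) (T : X -> X) (x : X)
    (n : nat) (f : X -> R) : R :=
  n.+1%:R^-1 * \sum_(j < n.+1) f (iter j T x).

Section OrbitAverage.
Context {R : realType} {X : Type} (T : X -> X) (x : X) (n : nat).
Implicit Types f g : X -> R.
Local Notation avg := (@orbit_average R X T x n).

Lemma orbit_averageD f g : avg (fun y => f y + g y) = avg f + avg g.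
Proof. by rewrite /orbit_average big_split mulrDr. Qed.

Lemma orbit_averageZ a f : avg (fun y => a * f y) = a * avg f.
Proof. by rewrite /orbit_average -mulr_sumr mulrCA. Qed.

Lemma orbit_average_cst a : avg (fun=> a) = a.
Proof.
rewrite /orbit_average sumr_const card_ord -[a in LHS]mulr1 -mulrnAr mulrC.
by rewrite -mulrA divff ?mulr1 ?pnatr_eq0.
Qed.

Lemma orbit_average_sum (I : finType) (h : I -> X -> R) :
  avg (fun y => \sum_i h i y) = \sum_i avg (h i).
Proof. by rewrite /orbit_average exchange_big mulr_sumr. Qed.

Lemma le_orbit_average f g : (forall y, f y <= g y) -> avg f <= avg g.
Proof.
by move=> fg; rewrite ler_wpM2l ?invr_ge0//; apply: ler_sum => j _.
Qed.

End OrbitAverage.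

Lemma Rintegral_empirical (R : realType) (X : ptopologicalType) (T : X -> X)
    (x : X) (n : nat) (f : X -> R) : continuous f -> bounded_fun f ->
  (\int[empirical R T x n]_y f y)%R = orbit_average T x n f.
Proof.
move=> cf bf.
have ge0E (g : X -> R) : continuous g -> (forall y, 0 <= g y) ->
    (\int[empirical R T x n]_y g y)%R = orbit_average T x n g.
  move=> cg g0; rewrite /Rintegral /empirical.
  have mg : measurable_fun setT (EFin \o g : borel X -> \bar R).
    apply/measurable_EFinP.
    exact: continuous_real_measurable.
  rewrite ge0_integral_mscale//; last by move=> y _; rewrite lee_fin.
  rewrite ge0_integral_measure_sum//; last by move=> y _; rewrite lee_fin.
  under eq_bigr do rewrite integral_dirac// diracT mul1e.
  by rewrite sumEFin.
(* The formulas for scaled measures and sums of measures were applied to nonnegative integrands. A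
   general [f] is raised by its bound [M], and the constant is cancelled afterwards. *)
have [M fM] := (bounded_funP _).1 bf.
have cfM : continuous (fun y => f y + M).
  by move=> y; apply: cvgD; [exact: cf|exact: cvg_cst].
have bM : bounded_fun (fun _ : X => M).
  by apply/bounded_funP; exists `|M|.
have := ge0E _ cfM _; rewrite RintegralD//; last 2 first.
- by apply: bounded_continuous_integrable.
- by apply: bounded_continuous_integrable => // y; exact: cvg_cst.
rewrite orbit_averageD orbit_average_cst (ge0E (fun=> M)); last 2 first.
- by move=> y; exact: cvg_cst.
- by move=> y; exact: le_trans (fM point).
rewrite orbit_average_cst => H; apply: (addIr M); apply: H => y.
by have := fM y; rewrite ler_norml => /andP[]; lra.
Qed.

(** * Limits of ultrafilters and the representing Borel probability *)

Definition closed_exhaustion (X : topologicalType) : Prop :=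
  forall U : set X, open U -> exists K : (set X)^nat,
    [/\ forall i, closed (K i), forall i, K i `<=` U &
        U `<=` \bigcup_i (K i)^°].

Section UltraLimit.
Context {X : ptopologicalType}.
Hypothesis compactX : compact [set: X].

Definition ultra_lim (G : ultrafilter X) : X := get [set x | sval G --> x].

Lemma ultra_limP (G : ultrafilter X) : sval G --> ultra_lim G.
Proof.
apply: (@getPex _ [set x | sval G --> x]).
move: compactX; rewrite compact_ultra => /(_ (sval G) (svalP G)).
by case=> [|x [_ Gx]]; [have := svalP G => ?; exact: filterT|exists x].
Qed.

Lemma ultra_lim_closed (G : ultrafilter X) (K : set X) :
  closed K -> sval G K -> K (ultra_lim G).
Proof.
have GU := svalP G; move=> cK GK.
apply: cK => B /ultra_limP GB.
by apply: (@filter_ex _ (sval G)); exact: filterI.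
Qed.

(** The preimage of an open [U] is a countable union of boxes. A limit in [U] is interior to some
    [K i], so [K i] belongs to the ultrafilter; conversely, a closed [K i] in the ultrafilter
    contains its limit. *)
Lemma measurable_ultra_lim : closed_exhaustion X ->
  measurable_fun setT (ultra_lim :
    g_sigma_algebraType (@measurable _ (ultrafilter X)) -> borel X).
Proof.
move=> exhX; apply: (measurability (@open X : set (set (borel X)))) => //.
move=> _ [U oU <-]; rewrite setTI.
have [K [cK KU UK]] := exhX _ oU.
have -> : ultra_lim @^-1` U = \bigcup_i ultra_box (K i).
  apply/seteqP; split => G /=.
    by move/UK => [i _ KiG]; exists i => //; exact: ultra_limP KiG.
  by move=> [i _ GKi]; apply: (KU i); exact: ultra_lim_closed.
apply: bigcupT_measurable => i; apply: sub_sigma_algebra.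
by exists (K i).
Qed.

End UltraLimit.

(* Applied to [f] and [- f] this determines the integral of [f], because the
   upper and lower Darboux sums of a bounded function are arbitrarily close. *)
Lemma finitely_additive_representation (R : realType) (X : ptopologicalType)
    (q : set X -> R) :
  compact [set: X] -> closed_exhaustion X -> finitely_additive_probability q ->
  exists mu : probability (borel X) R, forall f : X -> R,
    continuous f -> bounded_fun f ->
    forall (I : finType) (part : X -> I) (c : I -> R),
      (forall x, f x <= c (part x)) ->
      (\int[mu]_x f x)%R <= \sum_i c i * q (part @^-1` [set i]).
Proof.
move=> compactX exhX qP; pose nu := ultra_probability qP.
have mL := measurable_ultra_lim compactX exhX.
pose S := g_sigma_algebraType (@measurable _ (ultrafilter X)).
pose L : {mfun S >-> borel X} := HB.pack (ultra_lim : S -> borel X)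
    (isMeasurableFun.Build _ _ _ _ _ mL).
exists (distribution nu L) => f cf bf I part c fc.
have bfL : bounded_fun (f \o L).
  have [M fM] := (bounded_funP _).1 bf.
  by apply/bounded_funP; exists M => G /=.
have mfL : measurable_fun setT (f \o L).
  by apply: measurableT_comp => //; exact: continuous_real_measurable.
have ifL := bounded_measurable_integrable nu mfL bfL.
have -> : (\int[distribution nu L]_x f x)%R = (\int[nu]_G (f \o L) G)%R.
  rewrite /Rintegral integral_distribution//.
  by apply/measurable_EFinP; exact: continuous_real_measurable.
pose B i := ultra_box (part @^-1` [set i]).
have mB i : measurable (B i : set S).
  by apply: sub_sigma_algebra; exists (part @^-1` [set i]).
have iB i : nu.-integrable setT (EFin \o (fun G => c i * \1_(B i) G)).
  apply: bounded_measurable_integrable.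
    by apply: measurable_funM => //; exact: measurable_indic.
  apply/bounded_funP; exists `|c i| => G; rewrite normrM ler_piMr//.
  by rewrite indicE; case: (_ \in _); rewrite ?normr1 ?normr0.
(* The upper sum is the integral over the ultrafilters of the step function with value [c i] on
   [B i], so a pointwise comparison of integrands suffices. *)
have -> : \sum_i c i * q (part @^-1` [set i]) =
    (\int[nu]_G (\sum_i c i * \1_(B i) G))%R.
  rewrite /Rintegral; under eq_integral do rewrite -sumEFin.
  rewrite integral_sum//.
  have -> : (\sum_i \int[nu]_G (c i * \1_(B i) G)%:E =
      \sum_i (c i * q (part @^-1` [set i]))%:E)%E.
    apply: eq_bigr => i _; under eq_integral do rewrite EFinM.
    rewrite integralZl//; last first.
      exact: integrable_indic.
    by rewrite integral_indic// setIT /nu /= ultra_measure_box EFinM.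
  by rewrite sumEFin.
apply: le_Rintegral => //.
  rewrite (_ : _ \o _ = (fun G => \sum_i (c i * \1_(B i) G)%:E)%E).
    by apply: integrable_sum => // i _; exact: iB.
  by apply/funext => G /=; rewrite sumEFin.
move=> G _.
have GU := svalP G.
(* Since the cells are finitely many, [G] contains one of them, and only one by disjointness. On
   that cell [f] is at most [c i], a closed condition that passes to the limit of [G]. *)
have [i Gi] : exists i, sval G (part @^-1` [set i]).
  apply: contrapT => /forallNP nG.
  have : \forall x \near sval G, forall i, (~` (part @^-1` [set i])) x.
    apply: filter_forall => i.
    by have [|//] := in_ultra_setVsetC (part @^-1` [set i]) GU => /nG.
  by move=> /filter_ex[x /(_ (part x))]; exact.
have fGi : f (L G) <= c i.
  have clc : closed [set x | f x <= c i].
    by apply: (@closed_comp _ _ f [set r | r <= c i]) => // x _; exact: cf.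
  apply: (@ultra_lim_closed _ compactX G [set x | f x <= c i]) => //.
  by apply: filterS Gi => x /= <-.
rewrite (bigD1 i)//= indicE mem_set// mulr1 big1 ?addr0// => j ji.
rewrite indicE memNset ?mulr0// => Gj.
have : sval G (part @^-1` [set i] `&` part @^-1` [set j]) by exact: filterI.
rewrite (_ : _ `&` _ = set0) => [/filter_not_empty//|].
by rewrite -subset0 => x [/= -> /esym/eqP]; rewrite (negbTE ji).
Qed.

(** * Metric tools: closed exhaustions and approximation of indicators *)

Section MetricTopology.
Context {R : realType} {X : ptopologicalType} {d : X -> X -> R}.
Hypotheses (metd : is_metric d) (topd : metric_induces_topology d).

Lemma metric_ball_open x e : open [set y | d x y < e].
Proof.
case: metd => d0 dE dC dT; rewrite openE => y /= xye; apply/topd.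
exists (e - d x y) => [|z /= yz]; first by rewrite subr_gt0.
by have := dT x y z; lra.
Qed.

Lemma metric_continuousP (f : X -> R) : continuous f <->
  forall x e, 0 < e -> exists2 s, 0 < s & forall y, d x y < s -> `|f x - f y| < e.
Proof.
split=> [cf x e e0|H x].
  by have /cvgrPdist_lt/(_ _ e0)/topd := cf x.
apply/cvgrPdist_lt => e e0; apply/topd; exact: H.
Qed.

Lemma metric_closed_exhaustion : closed_exhaustion X.
Proof.
case: metd => d0 dE dC dT U oU.
pose r k : R := k.+1%:R^-1.
have r0 k : 0 < r k by rewrite invr_gt0.
(* Points whose ball of radius [r k] stays in [U]. If the ball of radius [e] about [x] lies in [U]
   and [r k < e / 2], then [K k] contains the whole ball of radius [r k] about [x]. *)
pose K k := [set x | forall y, d x y < r k -> U y].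
exists K; split => [k|k x|x Ux].
- rewrite -openC openE => x /= /existsNP[y /not_implyP[xy nUy]].
  apply/topd; exists (r k - d x y) => [|z /= xz]; first by rewrite subr_gt0.
  move/(_ y); apply: contra_not nUy; apply.
  by have := dT z x y; rewrite (dC z x); lra.
- by apply; rewrite (dE x x).2.
- have /topd[e e0 eU] : nbhs x U by exact: open_nbhs_nbhs.
  have [k] := @ltr_add_invr R 0 (e / 2) (divr_gt0 e0 (ltr0Sn _ 1)).
  rewrite add0r -/(r k) => ke; exists k => //; apply/topd; exists (r k) => //.
  by move=> y /= xy z yz; apply: eU => /=; have := dT x y z; lra.
Qed.

(** The approximants are the minimum of 1 and [n] times the distance to the complement of [U]: this
    distance is positive on [U] and vanishes off it. *)
Lemma open_indicator_approx (U : set X) : open U ->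
  exists h : nat -> X -> R, [/\ forall n, continuous (h n),
    forall n x, 0 <= h n x <= 1 &
    forall x, h n x @[n --> \oo] --> (\1_U x : R)].
Proof.
case: metd => d0 dE dC dT oU.
(* If [U] is the whole space there is no complement to measure the distance to, and the constant 1
   serves. Otherwise [a0] makes the infimum range over a nonempty set. *)
have [UT|/existsNP[a0 nUa0]] := pselect (forall x, U x).
  exists (fun _ _ => 1); split => [n x|n x|x].
  - exact: cvg_cst.
  - by rewrite ler01 lexx.
  - by rewrite indicE mem_set//; exact: cvg_cst.
pose dist x := inf [set d x a | a in ~` U].
have lbd x : has_lbound [set d x a | a in ~` U].
  by exists 0 => _ [a _ <-].
have dist_le x a : ~ U a -> dist x <= d x a.
  by move=> nUa; apply: ge_inf => //; exists a.
have dist_ge x r : (forall a, ~ U a -> r <= d x a) -> r <= dist x.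
  move=> H; apply: lb_le_inf; first by exists (d x a0), a0.
  by move=> _ [a nUa <-]; exact: H.
have dist0 x : 0 <= dist x by apply: dist_ge => a _.
have distL x y : dist x <= dist y + d x y.
  rewrite -lerBlDr; apply: dist_ge => a nUa.
  by have := dist_le x a nUa; have := dT x y a; lra.
have cdist : continuous dist.
  apply/metric_continuousP => x e e0; exists e => // y xy.
  have := distL x y; have := distL y x; rewrite (dC y x) ltr_norml.
  by move=> *; apply/andP; split; lra.
exists (fun n => (fun=> 1) \min (fun x => n%:R * dist x)); split => [n x|n x|x].
- apply: continuous_min; first exact: cvg_cst.
  by apply: cvgM; [exact: cvg_cst|exact: cdist].
- by rewrite /= le_min ler01 mulr_ge0// ge_min lexx.
- have [Ux|nUx] := pselect (U x).
    rewrite indicE mem_set//=.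
    have /topd[e e0 eU] : nbhs x U by exact: open_nbhs_nbhs.
    have ex : e <= dist x.
      by apply: dist_ge => a nUa; rewrite leNgt; apply: contra_notN nUa => /eU.
    have [k] := @ltr_add_invr R 0 e e0; rewrite add0r => ke.
    apply: cvg_near_cst; exists k.+1 => // n /= kn.
    apply/min_idPl.
    have kn' : k.+1%:R <= n%:R :> R by rewrite ler_nat.
    apply: (@le_trans _ _ (k.+1%:R * e)); last first.
      by apply: ler_pM => //; exact: ltW.
    by rewrite -ler_pdivrMl// mulr1 ltW.
  rewrite indicE memNset//=.
  have -> : dist x = 0.
    apply/eqP; rewrite eq_le dist0 andbT.
    by have := dist_le x x nUx; rewrite (dE x x).2.
  by under eq_fun do rewrite mulr0 (min_idPr ler01); exact: cvg_cst.
Qed.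

(** Dominated convergence along approximants of the indicator recovers the measure of each open set.
    The open sets are stable under intersection and generate the Borel sets, so uniqueness of
    measures applies. *)
Lemma probability_eq_continuous (mu nu : probability (borel X) R) :
  (forall f : X -> R, continuous f -> bounded_fun f ->
    (\int[mu]_x f x)%R = (\int[nu]_x f x)%R) ->
  forall A : set (borel X), measurable A -> mu A = nu A.
Proof.
move=> munu; apply: (measure_unique (@open X : set (set (borel X))) (fun=> setT)) => //.
- exact: openI.
- by move=> _; exact: openT.
- by rewrite bigcup_const.
- move=> U oU.
  have mU : measurable (U : set (borel X)) by exact: sub_sigma_algebra.
  have [h [ch h01 hU]] := open_indicator_approx oU.
  have bh n : bounded_fun (h n).
    by apply/bounded_funP; exists 1 => x; rewrite ger0_norm; case/andP: (h01 n x).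
  have cvgh (P : probability (borel X) R) :
      (\int[P]_x (h n x)%:E)%E @[n --> \oo] --> P U.
    have -> : P U = (\int[P]_x (\1_U x)%:E)%E by rewrite integral_indic// setIT.
    have [] := @dominated_convergence _ _ _ P setT measurableT
      (fun n x => (h n x)%:E) (fun x => (\1_U x)%:E) (cst 1%E) _ _ _ _ _ => //.
    + by move=> n; apply/measurable_EFinP; exact: continuous_real_measurable.
    + by apply/measurable_EFinP; exact: measurable_indic.
    + by apply: aeW => x _; apply: cvg_EFin; [exact: nearW|exact: hU].
    + exact: finite_measure_integrable_cst.
    + apply: aeW => x n _; rewrite lee_fin ger0_norm; case/andP: (h01 n x) => //.
  have hE n : (\int[mu]_x (h n x)%:E = \int[nu]_x (h n x)%:E)%E.
    rewrite -[LHS]fineK ?integrable_fin_num//; last first.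
      exact: bounded_continuous_integrable.
    rewrite -[RHS]fineK ?integrable_fin_num//; last first.
      exact: bounded_continuous_integrable.
    by congr EFin; exact: munu.
  have cvgnu : (\int[mu]_x (h n x)%:E)%E @[n --> \oo] --> nu U.
    by rewrite (funext hE); exact: cvgh.
  by apply: (cvg_unique _ (cvgh mu) cvgnu); exact: ereal_hausdorff.
- by move=> _; rewrite (le_lt_trans (probability_le1 mu measurableT)) ?ltry.
Qed.

End MetricTopology.

(** * Separability of the space of continuous functions *)

Definition uniformly_dense (R : realType) (X : topologicalType)
    (g : nat -> bounded_continuous R X) : Prop :=
  forall (f : bounded_continuous R X) (e : R), 0 < e ->
    exists i, forall x, `|sval (g i) x - sval f x| < e.

(** A code consists of a precision [m] and a finite list of balls covering [X], each with a rational
    value. There are countably many codes, and two functions fitting the same code differ by less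
    than [2 * r m] everywhere; one function is chosen for each code that some function fits. *)
Lemma dense_continuous_functions (R : realType) (X : ptopologicalType)
    (d : X -> X -> R) :
  is_metric d -> metric_induces_topology d -> separable X ->
  compact [set: X] ->
  exists g : nat -> bounded_continuous R X, uniformly_dense g.
Proof.
move=> metd topd [D /countable_injP[code codeI] denseD] compactX.
have [d0 dE dC dT] := metd.
pose p n := get [set x | D x /\ code x = n].
have pK x : D x -> p (code x) = x.
  move=> Dx; have [|Dp pE] := @getPex _ [set y | D y /\ code y = code x].
    by exists x.
  by apply: codeI; rewrite ?inE.
pose r k : R := k.+1%:R^-1.
have r0 k : 0 < r k by rewrite invr_gt0.
have rlt e : 0 < e -> exists k, r k < e.
  by move=> /ltr_add_invr[k]; rewrite add0r; exists k.
(* A triple holds the code of a centre in [D], the index of a radius and the rational value. At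
   integers coding no point of [D], the centre is arbitrary. *)
pose J : countType := (nat * nat * rat)%type.
pose ball (j : J) := [set y | d (p j.1.1) y < r j.1.2].
pose fits m (s : seq J) (f : X -> R) := (forall x, exists2 j, j \in s & ball j x) /\
  (forall j, j \in s -> forall x, ball j x -> `|f x - ratr j.2| < r m).
have /choice[g gP] : forall i : nat, exists g : bounded_continuous R X,
    forall m s, unpickle i = Some (m, s) ->
    (exists f : bounded_continuous R X, fits m s (sval f)) -> fits m s (sval g).
  move=> i; have [[[m s] [iE [f fs]]]|nf] := pselect (exists ms : nat * seq J,
      unpickle i = Some ms /\
      exists f : bounded_continuous R X, fits ms.1 ms.2 (sval f)).
    by exists f => m' s'; rewrite iE => -[<- <-].
  (* A code that no function fits receives the zero function as a dummy. *)
  have c0 : continuous (fun _ : X => 0 : R) by move=> x; exact: cvg_cst.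
  have b0 : bounded_fun (fun _ : X => 0 : R).
    by apply/bounded_funP; exists 0 => x; rewrite normr0.
  by exists (BoundedContinuous c0 b0) => m s iE fs; case: nf; exists (m, s).
exists g => f e e0.
have [m me] := rlt (e / 2) (divr_gt0 e0 (ltr0Sn _ 1)).
have [s fs] : exists s, fits m s (sval f).
  have rm2 : 0 < r m / 2 by rewrite divr_gt0.
  pose good (j : J) := forall x, ball j x -> `|sval f x - ratr j.2| < r m.
  move: compactX; rewrite compact_cover => /(_ J good ball).
  case=> [j _|x _|s sgood cover_s].
  - exact: metric_ball_open.
  (* Half of the tolerance [r m] pays for the oscillation of [f] near [x], the other half for the
     rational [q] near [f x]. With [r k < e1 / 2], the ball of radius [r k] about [y] stays within
     distance [e1] of [x]. *)
  - have [e1 e10 fe1] := (metric_continuousP topd (sval f)).1 (svalP f).1 x _ rm2.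
    have [k ke1] := rlt (e1 / 2) (divr_gt0 e10 (ltr0Sn _ 1)).
    have [|y [/= xy Dy]] :=
      denseD [set y | d x y < r k] _ (metric_ball_open metd topd x (r k)).
      by exists x => /=; rewrite (dE x x).2.
    have [|q] := @rat_in_itvoo R (sval f x - r m / 2) (sval f x + r m / 2).
      by lra.
    rewrite in_itv /= => /andP[q1 q2].
    exists (code y, k, q); last by rewrite /ball /= pK// dC.
    move=> z; rewrite /ball /= pK// => yz.
    have /fe1 : d x z < e1 by have := dT x y z; lra.
    by rewrite !ltr_norml => /andP[? ?]; apply/andP; split; lra.
  - exists (finmap.enum_fset s); split => [x|j js]; last first.
      by have := sgood _ js; rewrite inE.
    by have [j js bjx] := cover_s x I; exists j.
exists (pickle (m, s)) => x.
have [covs gs] := gP (pickle (m, s)) m s (pickleK _) (ex_intro _ f fs).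
have [j js bjx] := covs x.
have := gs _ js _ bjx; have := fs.2 _ js _ bjx.
by rewrite !ltr_norml => /andP[? ?] /andP[? ?]; apply/andP; split; lra.
Qed.

(** * The weak* topology through countably many integrals *)

Section WeakConvergence.
Context {R : realType} {X : ptopologicalType}.
Implicit Types (mu : borel_prob R X) (f : bounded_continuous R X).

Lemma integrals_continuous f :
  continuous (fun mu : borel_prob R X => integrals mu f).
Proof.
move=> mu.
apply: (@continuous_comp _ _ _ (@integrals R X : borel_prob R X -> {ptws _ -> _})
  (fun h : {ptws bounded_continuous R X -> R} => h f)).
  exact: initial_continuous.
move=> A; rewrite nbhsE => -[B [oB Bh] BA].
have /cvg_sup/(_ f) : nbhs (integrals mu : {ptws bounded_continuous R X -> R}) -->
  (integrals mu : {ptws bounded_continuous R X -> R}) by exact: cvg_id.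
apply; exists ((fun h : bounded_continuous R X -> R => h f) @^-1` B).
by split => //; [exists B|move=> h /BA].
Qed.

Lemma cvg_integrals (I : Type) (F : set_system I) (u : I -> borel_prob R X) mu f :
  Filter F -> u i @[i --> F] --> mu ->
  integrals (u i) f @[i --> F] --> integrals mu f.
Proof.
by move=> FF umu; apply: (continuous_cvg _ (@integrals_continuous f mu)).
Qed.

(** The topology is initial for [integrals], whose target is a product, so convergence can be tested
    on each coordinate [f]. *)
Lemma weak_cvg_integrals (F : set_system (borel_prob R X)) mu : Filter F ->
  (forall f, integrals nu f @[nu --> F] --> integrals mu f) -> F --> mu.
Proof.
move=> FF Fmu.
have : integrals nu @[nu --> F] --> (integrals mu : {ptws _ -> _}).
  apply/cvg_sup => f.
  move=> A [_ [[B oB <-] Bmu BA]]; apply: (filterS BA); apply: (Fmu f B).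
  exact: open_nbhs_nbhs.
move=> cF A [_ [[B oB <-] Bmu BA]].
apply: (filterS BA); apply: (cF B).
exact: open_nbhs_nbhs.
Qed.
End WeakConvergence.

(** Diagonal choice: stage [m] looks for an index satisfying [Q m] strictly beyond the one found at
    the preceding stage. *)
Lemma increasing_subsequence (Q : nat -> nat -> Prop) :
  (forall m N, exists2 n, (N <= n)%N & Q m n) ->
  exists2 k : nat -> nat, increasing_seq k & forall m, Q m (k m).
Proof.
move=> H.
have /choice[s sP] : forall mN : nat * nat,
    exists n, (mN.2 <= n)%N /\ Q mN.1 n.
  by move=> [m N]; have [n] := H m N; exists n.
pose k := fix k m := if m is m'.+1 then s (m'.+1, (k m').+1) else s (0%N, 0%N).
exists k; last by case=> [|m]; exact: (sP (_, _)).2.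
by apply/increasing_seqP => m; exact: (sP (_, _)).1.
Qed.

Lemma Rintegral_dist (R : realType) (X : ptopologicalType)
    (mu : probability (borel X) R) (f h : X -> R) (e : R) :
  continuous f -> bounded_fun f -> continuous h -> bounded_fun h ->
  (forall x, `|f x - h x| <= e) ->
  `|(\int[mu]_x f x)%R - (\int[mu]_x h x)%R| <= e.
Proof.
move=> cf bf ch bh fh.
have intf := bounded_continuous_integrable mu cf bf.
have inth := bounded_continuous_integrable mu ch bh.
have inte : mu.-integrable setT (EFin \o (fun _ : borel X => e)).
  exact: finite_measure_integrable_cst.
have inte' : (\int[mu]_x e)%R = e.
  by rewrite Rintegral_cst//= probability_setT mulr1.
have half (f1 f2 : X -> R) : mu.-integrable setT (EFin \o f1) ->
    mu.-integrable setT (EFin \o f2) -> (forall x, f1 x <= f2 x + e) ->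
    (\int[mu]_x f1 x)%R <= (\int[mu]_x f2 x)%R + e.
  move=> if1 if2 f12; rewrite -[X in _ + X]inte' -RintegralD//.
  by apply: le_Rintegral => //; exact: (integrableD measurableT if2 inte).
have fh' : forall x, f x <= h x + e.
  by move=> x; have := fh x; rewrite ler_norml => /andP[]; lra.
have hf' : forall x, h x <= f x + e.
  by move=> x; have := fh x; rewrite ler_norml => /andP[]; lra.
have := half _ _ intf inth fh'; have := half _ _ inth intf hf'.
by rewrite ler_norml => ? ?; apply/andP; split; lra.
Qed.

Section WeakTopology.
Context {R : realType} {X : ptopologicalType}.
Implicit Types (mu : borel_prob R X) (f : bounded_continuous R X).

Lemma integrals_dist mu f h (e : R) :
  (forall x, `|sval f x - sval h x| <= e) ->
  `|integrals mu f - integrals mu h| <= e.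
Proof.
by move=> fh; have [[? ?] [? ?]] := (svalP f, svalP h); exact: Rintegral_dist.
Qed.

Lemma cvg_integrals_dist (u : nat -> borel_prob R X) mu f (r : R) :
  u n @[n --> \oo] --> mu ->
  `|integrals (u n) f - r| @[n --> \oo] --> `|integrals mu f - r|.
Proof.
move=> umu; apply: cvg_norm; apply: cvgB; last exact: cvg_cst.
exact: cvg_integrals.
Qed.

Context (g : nat -> bounded_continuous R X).
Hypothesis gdense : uniformly_dense g.

(** Integration against a probability is 1-Lipschitz for the uniform distance, so replacing [f] by a
    nearby [g i] costs [e / 3] twice, uniformly in the measure. *)
Lemma weak_cvg_dense (u : nat -> borel_prob R X) mu :
  (forall i, integrals (u n) (g i) @[n --> \oo] --> integrals mu (g i)) ->
  u n @[n --> \oo] --> mu.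
Proof.
move=> umu; apply: weak_cvg_integrals => f.
apply/cvgrPdist_lt => e e0.
have e3 : 0 < e / 3 by rewrite divr_gt0.
have [i gif] := gdense f e3.
have dist nu : `|integrals nu (g i) - integrals nu f| <= e / 3.
  by apply: integrals_dist => x; exact/ltW.
have /cvgrPdist_lt/(_ _ e3) := umu i; apply: filterS => n /=.
have := dist mu; have := dist (u n).
rewrite !ler_norml !ltr_norml => /andP[? ?] /andP[? ?] /andP[? ?].
by apply/andP; split; lra.
Qed.

(** With rational centres these sets form a countable family indexed by [m] and [s]. The companion
    with weak inequalities contains all limits of sequences from the strict one. *)
Definition test_open m (s : seq rat) : set (borel_prob R X) :=
  [set mu | forall i, (i < m)%N -> `|integrals mu (g i) - ratr s`_i| < m.+1%:R^-1].

Definition test_closed m (s : seq rat) : set (borel_prob R X) :=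
  [set mu | forall i, (i < m)%N -> `|integrals mu (g i) - ratr s`_i| <= m.+1%:R^-1].

(** Choose for each [m] rational centres close to the integrals of [mu]. If every closed test set so
    centred left [O], points chosen outside [O] would converge to [mu] by [weak_cvg_dense], which is
    impossible as [O] is a neighbourhood of [mu]. *)
Lemma test_open_nbhs (O : set (borel_prob R X)) mu : open O -> O mu ->
  exists m s, test_open m s mu /\ test_closed m s `<=` O.
Proof.
move=> oO Omu.
pose r k : R := k.+1%:R^-1.
have r0 k : 0 < r k by rewrite invr_gt0.
have /choice[s sP] : forall m, exists s, test_open m s mu.
  move=> m.
  have /choice[q qP] : forall i, exists q,
      `|integrals mu (g i) - ratr q| < r m.
    move=> i; have [|q] :=
        @rat_in_itvoo R (integrals mu (g i) - r m) (integrals mu (g i) + r m).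
      by have := r0 m; lra.
    rewrite in_itv /= => /andP[? ?]; exists q.
    by rewrite ltr_norml; apply/andP; split; lra.
  by exists (mkseq q m) => i im; rewrite nth_mkseq.
apply: contrapT => nH.
have /choice[nu nuP] : forall m, exists nu, test_closed m (s m) nu /\ ~ O nu.
  move=> m; apply: contrapT => /forallNP Hm; apply: nH; exists m, (s m).
  split; first exact: sP.
  by move=> nu nuc; apply: contrapT => nO; exact: (Hm nu).
have : nu m @[m --> \oo] --> mu.
  apply: weak_cvg_dense => i; apply/cvgrPdist_lt => e e0.
  have e2 : 0 < e / 2 by rewrite divr_gt0.
  near=> m.
  have im : (i < m)%N by near: m; exact: nbhs_infty_gt.
  have rm : r m < e / 2.
    by near: m; exact: (near_infty_natSinv_lt (PosNum e2)).
  have := sP m i im; have := (nuP m).1 i im; rewrite -/(r m).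
  rewrite !ler_norml !ltr_norml => /andP[? ?] /andP[? ?].
  by apply/andP; split; lra.
move=> /(_ O)[|N _ NO]; first exact: open_nbhs_nbhs.
exact: (nuP N).2 (NO N (leqnn N)).
Unshelve. all: by end_near. Qed.

End WeakTopology.

(** * Ultralimits of orbit averages *)

Lemma ultra_cvg_bounded (R : realType) (T : Type) (F : set_system T)
    (u : T -> R) (M : R) : UltraFilter F -> (forall n, `|u n| <= M) ->
  cvg (u @ F).
Proof.
move=> FU uM.
have uF : ProperFilter (u @ F) by exact: fmap_proper_filter.
have [|l [_ cl]] := @segment_compact R (- M) M (u @ F) uF.
  by apply: (@filterE _ F) => n /=; rewrite in_itv /= -ler_norml.
apply/cvg_ex; exists l => A /= lA.
(* An ultrafilter converges to each of its cluster points: otherwise it would contain the complement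
   of some neighbourhood, which the cluster point forbids. *)
have [//|FnA] := in_ultra_setVsetC (u @^-1` A) FU.
have : (~` A `&` A) !=set0 by exact: cl.
by rewrite setICl => -[].
Qed.

Section UltraAverage.
Context {R : realType} {X : ptopologicalType} (T : X -> X) (x : X).
Context (F : set_system nat) {FU : UltraFilter F}.
Local Notation avg n := (@orbit_average R X T x n).

Lemma orbit_average_bound n (f : X -> R) M :
  (forall y, `|f y| <= M) -> `|avg n f| <= M.
Proof.
move=> fM; rewrite ler_norml; apply/andP; split.
  rewrite -(@orbit_average_cst R X T x n (- M)); apply: le_orbit_average => y.
  by have := fM y; rewrite ler_norml => /andP[].
rewrite -[leRHS](@orbit_average_cst R X T x n M); apply: le_orbit_average => y.
by have := fM y; rewrite ler_norml => /andP[].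
Qed.

Lemma cvg_ultra_average (f : X -> R) M :
  (forall y, `|f y| <= M) -> cvg (avg n f @[n --> F]).
Proof.
by move=> fM; apply: ultra_cvg_bounded => n; exact: orbit_average_bound.
Qed.

(** The asymptotic frequency of visits to [A] along [F]. It exists for every subset, Borel or not,
    and is the finitely additive [q] fed to the representation. *)
Definition ultra_frequency (A : set X) : R := lim (avg n (\1_A) @[n --> F]).

Lemma cvg_ultra_frequency (A : set X) :
  avg n (\1_A) @[n --> F] --> ultra_frequency A.
Proof.
apply: (@cvg_ultra_average _ 1) => y.
by rewrite indicE; case: (_ \in _); rewrite ?normr1 ?normr0.
Qed.

Lemma ultra_frequency_fap : finitely_additive_probability ultra_frequency.
Proof.
split => [A||A B AB0].
- have cvgA := cvgP _ (@cvg_ultra_frequency A).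
  apply: (limr_ge cvgA).
  apply: nearW => n.
  rewrite -[leLHS](@orbit_average_cst R X T x n 0).
  by apply: le_orbit_average => y; rewrite indicE.
- apply: cvg_lim => //; rewrite (_ : (fun n => _) = (fun=> 1)); first exact: cvg_cst.
  by apply/funext => n; rewrite indicT orbit_average_cst.
- apply: cvg_lim => //.
  rewrite (_ : (fun n => _) = (fun n => avg n (\1_A) + avg n (\1_B))).
    by apply: cvgD; exact: cvg_ultra_frequency.
  apply/funext => n; rewrite -orbit_averageD; congr orbit_average.
  apply/funext => y; rewrite !indicE in_setU.
  have [yA|] := boolP (y \in A); have [yB|] := boolP (y \in B);
    rewrite ?addr0 ?add0r//.
  have : (A `&` B) y by split; exact: set_mem.
  by rewrite AB0.
Qed.

(** For the measure representing [ultra_frequency], upper sums bound the integral of [f] by the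
    limit of its averages. The same bound for [- f] gives equality. *)
Lemma ultra_average_measure : compact [set: X] -> closed_exhaustion X ->
  exists mu : borel_prob R X, forall f : bounded_continuous R X,
    avg n (sval f) @[n --> F] --> integrals mu f.
Proof.
move=> compactX exhX.
have [mu muP] := finitely_additive_representation compactX exhX ultra_frequency_fap.
have upper (f : X -> R) : continuous f -> bounded_fun f ->
    (\int[mu]_y f y)%R <= lim (avg n f @[n --> F]).
  move=> cf bf; have [M fM] := (bounded_funP _).1 bf.
  have M0 : 0 <= M by exact: le_trans (fM point).
  apply/ler_addgt0Pr => e e0.
  (* The range of [f] lies in [[-M, M]] and is cut into slices of height [e]; [c] is the top of a
     slice, so [c (part y)] lies between [f y] and [f y + e]. *)
  pose cell y := Num.truncn ((f y + M) / e).
  pose K := Num.truncn (2 * M / e).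
  have fM0 y : 0 <= (f y + M) / e.
    apply: divr_ge0; last exact: ltW.
    by have := fM y; rewrite ler_norml => /andP[]; lra.
  have cellK y : (cell y < K.+1)%N.
    rewrite ltnS; apply: le_truncn; rewrite ler_pM2r ?invr_gt0//.
    by have := fM y; rewrite ler_norml => /andP[]; lra.
  pose part y : 'I_K.+1 := Ordinal (cellK y).
  pose c (i : 'I_K.+1) : R := i.+1%:R * e - M.
  have fc y : f y <= c (part y).
    rewrite lerBrDr -ler_pdivrMr//; apply/ltW; exact: truncnS_gt.
  have cf' y : c (part y) <= f y + e.
    have : (cell y)%:R <= (f y + M) / e by rewrite truncn_le.
    by rewrite ler_pdivlMr// /c /= -/(cell y) -natr1 mulrDl mul1r; lra.
  apply: (le_trans (muP f cf bf _ part c fc)).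
  (* The upper sum is itself the limit along [F] of the averages of the step function, which exceed
     those of [f] by at most [e]. *)
  have cvgc : avg n (fun y => c (part y)) @[n --> F] -->
      \sum_i c i * ultra_frequency (part @^-1` [set i]).
    rewrite (_ : (fun n => _) =
        (fun n => \sum_i c i * avg n (\1_(part @^-1` [set i])))).
      apply: cvg_big => // [|i _]; first exact: add_continuous.
      apply: cvgM; first exact: cvg_cst.
      exact: cvg_ultra_frequency.
    apply/funext => n; under [RHS]eq_bigr do rewrite -orbit_averageZ.
    rewrite -orbit_average_sum; congr orbit_average; apply/funext => y.
    rewrite (bigD1 (part y))//= indicE mem_set// mulr1 big1 ?addr0// => i iy.
    by rewrite indicE memNset ?mulr0// => /= /esym/eqP; rewrite (negbTE iy).
  rewrite -(cvg_lim _ cvgc)//.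
  have cvge : avg n (fun y => f y + e) @[n --> F] --> lim (avg n f @[n --> F]) + e.
    rewrite (_ : (fun n => _) = (fun n => avg n f + e)).
      by apply: cvgD; [exact: cvg_ultra_average fM|exact: cvg_cst].
    by apply/funext => n; rewrite orbit_averageD orbit_average_cst.
  rewrite -(cvg_lim _ cvge)//; apply: ler_lim; [exact: cvgP cvgc|exact: cvgP cvge|].
  by apply: nearW => n; exact: le_orbit_average.
exists mu => -[f [cf bf]] /=; have [M fM] := (bounded_funP _).1 bf.
have cvgf := cvg_ultra_average fM.
suff -> : integrals mu (exist _ f (conj cf bf)) = lim (avg n f @[n --> F]) by [].
apply/eqP; rewrite eq_le upper//=.
have cNf : continuous (fun y => - f y) by move=> y; apply: cvgN; exact: cf.
have bNf : bounded_fun (fun y => - f y).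
  by apply/bounded_funP; exists M => y; rewrite normrN.
have := upper _ cNf bNf.
have avgN n : avg n (fun y => - f y) = - avg n f.
  by under [in LHS]eq_fun do rewrite -mulN1r; rewrite orbit_averageZ mulN1r.
have -> : lim (avg n (fun y => - f y) @[n --> F]) = - lim (avg n f @[n --> F]).
  by apply: cvg_lim => //; rewrite (funext avgN); exact: cvgN.
rewrite /integrals /=.
have intf := bounded_continuous_integrable mu cf bf.
rewrite (_ : (\int[mu]_y (- f y))%R = - (\int[mu]_y f y)%R) ?lerN2//.
under eq_Rintegral do rewrite -mulN1r.
by rewrite RintegralZl// mulN1r.
Qed.

End UltraAverage.

(** * Sequential compactness of the empirical measures *)

Section Empirical.
Context {R : realType} {X : ptopologicalType} (T : X -> X).

Lemma integrals_empirical x n (f : bounded_continuous R X) :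
  integrals (empirical_prob R T x n) f = orbit_average T x n (sval f).
Proof. by case: f => f [cf bf]; exact: Rintegral_empirical. Qed.

(** An arbitrary infinite set [P] of times is allowed, so that the subsequence can be confined to
    the visits to a given test set. *)
Lemma empirical_accumulation (g : nat -> bounded_continuous R X) x
    (P : set nat) : uniformly_dense g ->
  compact [set: X] -> closed_exhaustion X ->
  (forall N, exists2 n, (N <= n)%N & P n) ->
  exists k : nat -> nat, exists mu : borel_prob R X,
    [/\ increasing_seq k, forall n, P (k n) &
        empirical_prob R T x (k n) @[n --> \oo] --> mu].
Proof.
move=> gdense compactX exhX Pinf.
(* An ultrafilter containing all these tails meets [P] arbitrarily late: any condition holding on a
   set of [F] holds at some [n] in [P] beyond any bound. *)
pose tail N := [set n | (N <= n)%N /\ P n].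
have tailF : ProperFilter (filter_from setT tail).
  apply: filter_from_proper; last first.
    by move=> N _; have [n Nn Pn] := Pinf N; exists n.
  apply: filter_from_filter; first by exists 0%N.
  move=> i j _ _; exists (maxn i j) => // n [].
  by rewrite geq_max => /andP[? ?] ?; split.
have [F [FU tF]] := ultraFilterLemma tailF.
have Ftail N : F (tail N) by apply: tF; exists N.
have [mu muP] := @ultra_average_measure R X T x F FU compactX exhX.
(* Stage [m] constrains only the first [m] test functions, a finite condition that holds on a set of
   [F]; each [g i] is constrained from stage [i.+1] on. *)
have [|k kincr kP] := @increasing_subsequence (fun m n =>
    P n /\ forall i, (i < m)%N ->
    `|integrals mu (g i) - orbit_average T x n (sval (g i))| < m.+1%:R^-1).
  move=> m N.
  have near_g : F [set n | forall i : 'I_m,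
      `|integrals mu (g i) - orbit_average T x n (sval (g i))| < m.+1%:R^-1].
    apply: filter_forall => i.
    have /cvgrPdist_lt := muP (g i); apply.
    by rewrite invr_gt0.
  have [n [[Nn Pn] gn]] := filter_ex (filterI (Ftail N) near_g).
  by exists n => //; split => // i im; exact: (gn (Ordinal im)).
exists k, mu; split => //; first by move=> n; exact: (kP n).1.
apply: (weak_cvg_dense gdense) => i; apply/cvgrPdist_lt => e e0.
near=> m; rewrite integrals_empirical.
apply: (lt_trans ((kP m).2 i _)); first by near: m; exact: nbhs_infty_gt.
by near: m; exact: (near_infty_natSinv_lt (PosNum e0)).
Unshelve. all: by end_near. Qed.

End Empirical.

Lemma increasing_seq_ge (k : nat -> nat) n : increasing_seq k -> (n <= k n)%N.
Proof.
move=> /increasing_seqP kincr; elim: n => // n IH.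
exact: leq_ltn_trans IH (kincr n).
Qed.

(** * Dependence on the initial point and invariance of limit measures *)

Section OrbitContinuity.
Context {R : realType} {X : ptopologicalType} {T : X -> X}.
Hypothesis contT : continuous T.

Lemma iter_continuous n : continuous (iter n T).
Proof.
elim: n => [|n IH] x; first exact: cvg_id.
by apply: (@continuous_comp _ _ _ (iter n T) T); [exact: IH|exact: contT].
Qed.

Lemma orbit_average_continuous n (f : X -> R) :
  continuous f -> continuous (fun x => orbit_average T x n f).
Proof.
move=> cf x; apply: cvgM; first exact: cvg_cst.
apply: cvg_big => [|j _]; first exact: add_continuous.
by apply: (@continuous_comp _ _ _ (iter j T) f); [exact: iter_continuous|exact: cf].
Qed.

Lemma orbit_average_shift n x (f : X -> R) :
  orbit_average T x n (f \o T) - orbit_average T x n f =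
  n.+1%:R^-1 * (f (iter n.+1 T x) - f x).
Proof.
rewrite /orbit_average -mulrBr -sumrB; congr (_ * _).
rewrite -(big_mkord xpredT (fun j => f (iter j.+1 T x) - f (iter j T x))).
by rewrite telescope_sumr.
Qed.

(** For fixed [n] the condition is a finite set of strict inequalities between continuous functions
    of [x]. *)
Lemma test_open_empirical_open (g : nat -> bounded_continuous R X) m s n :
  open [set x | test_open g m s (empirical_prob R T x n)].
Proof.
rewrite openE => x xO.
have : \forall y \near x, forall i : 'I_m,
    `|integrals (empirical_prob R T y n) (g i) - ratr s`_i| < m.+1%:R^-1.
  apply: filter_forall => i.
  under eq_near do rewrite integrals_empirical.
  have := xO i (ltn_ord i); rewrite integrals_empirical => xi.
  have cabs : continuous (fun y => `|orbit_average T y n (sval (g i)) - ratr s`_i|).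
    move=> y; apply: cvg_norm; apply: cvgB; last exact: cvg_cst.
    by apply: orbit_average_continuous; exact: (svalP (g i)).1.
  exact: cvgr_lt (cabs x) _ xi.
by apply: filterS => y yP i im; exact: (yP (Ordinal im)).
Qed.

End OrbitContinuity.

(** Composing [f] with [T] changes an orbit average only by a telescoped boundary term, of size at
    most [2 * M / n.+1]. Hence [mu] and its image under [T] integrate every continuous function
    alike, and so agree on Borel sets. *)
Lemma limit_measures_invariant (R : realType) (X : ptopologicalType)
    (d : X -> X -> R) (T : X -> X) (x : X) :
  is_metric d -> metric_induces_topology d -> continuous T ->
  limit_measures R T x `<=` invariant_measures R T.
Proof.
move=> metd topd contT mu [k kincr kmu].
have cvg_int (f : bounded_continuous R X) :
    orbit_average T x (k n) (sval f) @[n --> \oo] --> integrals mu f.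
  rewrite -(funext (fun n => integrals_empirical T x (k n) f)).
  exact: cvg_integrals.
pose Tm : {mfun borel X >-> borel X} := HB.pack (T : borel X -> borel X)
  (isMeasurableFun.Build _ _ _ _ _ (continuous_borel_measurable contT)).
pose P : probability (borel X) R := mu.
move=> A mA.
have := @probability_eq_continuous R X d metd topd (distribution P Tm) P.
apply => // f cf bf.
have cfT : continuous (f \o T).
  by move=> y; apply: continuous_comp; [exact: contT|exact: cf].
have [M fM] := (bounded_funP _).1 bf.
have bfT : bounded_fun (f \o T) by apply/bounded_funP; exists M => y /=.
rewrite (_ : (\int[distribution P Tm]_y f y)%R = (\int[P]_y (f \o T) y)%R); last first.
  rewrite /Rintegral integral_distribution//.
    by apply/measurable_EFinP; exact: continuous_real_measurable.
  exact: bounded_continuous_integrable.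
have cvg1 := cvg_int (BoundedContinuous cfT bfT).
have cvg2 := cvg_int (BoundedContinuous cf bf).
apply/eqP; rewrite -subr_eq0; apply/eqP.
have cvg3 : orbit_average T x (k n) (f \o T) - orbit_average T x (k n) f
    @[n --> \oo] --> (\int[P]_y (f \o T) y)%R - (\int[P]_y f y)%R.
  exact: (cvgB cvg1 cvg2).
suff cvg0 : orbit_average T x (k n) (f \o T) - orbit_average T x (k n) f
    @[n --> \oo] --> 0.
  exact: (cvg_unique (@Rhausdorff R) cvg3 cvg0).
apply/cvgrPdist_lt => e e0.
have M0 : 0 <= M by exact: le_trans (fM point).
(* The summand 1 keeps the divisor positive when [M] is 0. *)
have e' : 0 < e / (2 * M + 1) by rewrite divr_gt0//; lra.
near=> n => /=; rewrite sub0r normrN orbit_average_shift normrM.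
have kn : (k n).+1%:R^-1 < e / (2 * M + 1).
  apply: (@le_lt_trans _ _ n.+1%:R^-1).
    by rewrite lef_pV2 ?posrE// ler_nat ltnS increasing_seq_ge.
  by near: n; exact: (near_infty_natSinv_lt (PosNum e')).
rewrite ger0_norm ?invr_ge0//.
apply: (@le_lt_trans _ _ ((k n).+1%:R^-1 * (2 * M + 1))).
  rewrite ler_wpM2l ?invr_ge0//.
  apply: (le_trans (ler_normB _ _)).
  by have := fM x; have := fM (iter (k n).+1 T x); lra.
by rewrite -ltr_pdivlMr//; lra.
Unshelve. all: by end_near. Qed.

(** * Borel complexity of the sets of points *)

Lemma Sigma03_meets_open (R : realType) (X : ptopologicalType) (T : X -> X)
    (O : set (borel_prob R X)) :
  polish R X -> continuous T -> compact [set: X] -> open O ->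
  Sigma03 [set x | limit_measures R T x `&` O !=set0].
Proof.
move=> [sepX [d [metd topd _]]] contT compactX oO.
have [g gdense] := dense_continuous_functions metd topd sepX compactX.
pose often m s : set X := \bigcap_N \bigcup_(n in [set n | (N <= n)%N])
  [set x | test_open g m s (empirical_prob R T x n)].
(* Integers that code no pair, and pairs whose closed test set leaves [O], contribute the empty
   set. *)
pose G i : set X := if unpickle i is Some (m, s)
  then (if `[< test_closed g m s `<=` O >] then often m s else set0) else set0.
exists G.
  move=> i; rewrite /G; case: unpickle => [[m s]|]; last exact/open_Gdelta/open0.
  case: asboolP => _; last exact/open_Gdelta/open0.
  exists (fun N => \bigcup_(n in [set n | (N <= n)%N])
    [set x | test_open g m s (empirical_prob R T x n)]) => // N.
  by apply: bigcup_open => n _; exact: test_open_empirical_open.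
apply/seteqP; split => x /=.
- move=> [mu [[k kincr kmu] Omu]].
  have [m [s [omu sO]]] := test_open_nbhs gdense oO Omu.
  exists (pickle (m, s)) => //; rewrite /G pickleK; case: asboolP => // _ N _.
  have near_k (i : 'I_m) : \forall n \near \oo,
      `|integrals (empirical_prob R T x (k n)) (g i) - ratr s`_i| < m.+1%:R^-1.
    have /cvgr_lt := @cvg_integrals_dist _ _ _ _ (g i) (ratr s`_i) kmu.
    by apply; exact: omu.
  have [n _ nk] := filter_forall _ near_k.
  (* Position [maxn n N] is late enough for the test inequalities, and its time is at least [N]
     because [k] is strictly increasing. *)
  exists (k (maxn n N)).
    exact: leq_trans (leq_maxr n N) (increasing_seq_ge _ kincr).
  by move=> i im; exact: (nk _ (leq_maxl n N) (Ordinal im)).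
- move=> [i _]; rewrite /G; case: unpickle => [[m s]|//].
  case: asboolP => // sO xoften.
  have exhX := metric_closed_exhaustion metd topd.
  pose P := [set n | test_open g m s (empirical_prob R T x n)].
  have Pinf N : exists2 n, (N <= n)%N & P n by have [n] := xoften N I; exists n.
  have [k [mu [kincr kP kmu]]] :=
    empirical_accumulation T x gdense compactX exhX Pinf.
  exists mu; split; first by exists k.
  (* The strict inequalities at the times [k n] weaken in the limit, so [mu] is only known to lie in
     the closed test set; this is why the closed set was required to be inside [O]. *)
  apply: sO => j jm.
  have cvgj := @cvg_integrals_dist _ _ _ _ (g j) (ratr s`_j) kmu.
  rewrite -(cvg_lim _ cvgj)//; apply: limr_le; first exact: cvgP cvgj.
  by apply: nearW => n; apply/ltW; exact: kP.
Qed.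

Lemma Sigma03C (X : topologicalType) (S : set X) : Sigma03 S -> Pi03 (~` S).
Proof.
move=> [F FG ->]; exists (fun i => ~` F i); last by rewrite setC_bigcup.
move=> i; have [H oH ->] := FG i; exists (fun j => ~` H j).
  by move=> j; exact: open_closedC.
by rewrite setC_bigcap.
Qed.

Theorem fact20 (R : realType) (X : ptopologicalType) (T : X -> X)
    (polishX : polish R X) (contT : continuous T)
    (compactX : compact [set: X]) :
  (forall V : set (borel_prob R X),
     closed_in (invariant_measures R T) V ->
     Pi03 [set x : X | limit_measures R T x `<=` V]) /\
  (forall U : set (borel_prob R X),
     open_in (invariant_measures R T) U ->
     Sigma03 [set x : X | limit_measures R T x `&` U !=set0]).
Proof.
(* Since all limit measures are invariant, relatively open or closed sets can be replaced by open or
   closed sets of the full space of probabilities. *)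
have inv x : limit_measures R T x `<=` invariant_measures R T.
  have [_ [d [metd topd _]]] := polishX.
  exact: limit_measures_invariant metd topd contT.
split=> [_ [C cC ->]|_ [W oW ->]].
(* All limit measures lie in [C] exactly when none lies in the open complement of [C], so the closed
   case is the complement of an open one. *)
- have -> : [set x | limit_measures R T x `<=` C `&` invariant_measures R T] =
      ~` [set x | limit_measures R T x `&` ~` C !=set0].
    apply/seteqP; split => x /=.
      by move=> VC [mu [xmu]]; apply; have [] := VC _ xmu.
    move=> nVC mu xmu; split; last exact: inv xmu.
    by apply: contrapT => nC; apply: nVC; exists mu.
  apply: Sigma03C; apply: Sigma03_meets_open => //; exact: closed_openC.
- have -> : [set x | limit_measures R T x `&` (W `&` invariant_measures R T) !=set0] =
      [set x | limit_measures R T x `&` W !=set0].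
    apply/seteqP; split => x [mu [xmu]] /=; first by case=> Wmu _; exists mu.
    by exists mu; split => //; split => //; exact: inv xmu.
  exact: Sigma03_meets_open.
Qed.
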